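(* Let $\mathcal{C}$ be a category having a null object and finite sums, and let $n\ge1$. There exists a preadditive category $T_n\bar{\mathbb{Z}}[\mathcal{C}]$ with the same objects as $\mathcal{C}$ whose morphism sets are given by $\mathrm{Hom}_{T_n\bar{\mathbb{Z}}[\mathcal{C}]}(X,Y)=T_nU_X^{\mathcal{C}}(Y)$ and whose composition satisfies $t_ng\circ t_nf=t_n(g\circ f)$ for all morphisms $f:X\to Y$ and $g:Y\to Z$ of $\mathcal{C}$.
   Context: Let $\vee$ denote the finite sum (coproduct) in $\mathcal{C}$. For a functor $F:\mathcal{C}\to Ab$ and $m\ge1$, $cr_mF(X_1,\dots,X_m)=\ker\big(F(X_1\vee\cdots\vee X_m)\to\bigoplus_{k=1}^mF(X_1\vee\cdots\vee\widehat{X_k}\vee\cdots\vee X_m)\big)$, the components being induced by the retractions killing the $k$-th summand. The $n$-Taylorisation of $F$ is the functor $T_nF$ with $T_nF(X)=\mathrm{coker}\big(cr_{n+1}F(X,\dots,X)\hookrightarrow F(X\vee\cdots\vee X)\xrightarrow{F(\nabla^{n+1})}F(X)\big)$, where $\nabla^{n+1}$ is the folding map of $n+1$ copies of $X$; $t_n:F\to T_nF$ is the quotient map. For $X\in\mathcal{C}$, $U_X^{\mathcal{C}}:\mathcal{C}\to Ab$ is the functor $U_X^{\mathcal{C}}(Y)=\mathbb{Z}[\mathrm{Hom}_{\mathcal{C}}(X,Y)]/\mathbb{Z}[\{0\}]$ (free abelian group on $\mathrm{Hom}_{\mathcal{C}}(X,Y)$ modulo the subgroup generated by the zero morphism). For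 $f\in\mathrm{Hom}_{\mathcal{C}}(X,Y)$, $t_nf\in T_nU_X^{\mathcal{C}}(Y)$ denotes the image of the class of $f$. *)

(* Defs.v *)
From HB Require Import structures.
From mathcomp Require Import all_boot all_algebra ring_quotient.
From mathcomp Require Import boolp freeg.

Set Implicit Arguments.
Unset Strict Implicit.
Unset Printing Implicit Defensive.

Import GRing.Theory.
Local Open Scope ring_scope.
Local Open Scope quotient_scope.

Reserved Notation "g \oc f" (at level 50, left associativity).

Record category := Category {
  obj :> Type;
  mor : obj -> obj -> Type;
  idm : forall X, mor X X;
  mcomp : forall X Y Z, mor Y Z -> mor X Y -> mor X Z;
  compA : forall W X Y Z (h : mor Y Z) (g : mor X Y) (f : mor W X),
    mcomp h (mcomp g f) = mcomp (mcomp h g) f;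
  comp1m : forall X Y (f : mor X Y), mcomp (idm Y) f = f;
  compm1 : forall X Y (f : mor X Y), mcomp f (idm X) = f }.

Arguments idm {c} X.
Arguments mcomp {c X Y Z} g f.
Notation "g \oc f" := (mcomp g f).

Record null_object (C : category) := NullObject {
  null :> C;
  from_null : forall X : C, mor null X;
  to_null : forall X : C, mor X null;
  from_null_uniq : forall (X : C) (f : mor null X), f = from_null X;
  to_null_uniq : forall (X : C) (f : mor X null), f = to_null X }.

Definition zerom (C : category) (O : null_object C) (X Y : C) : mor X Y :=
  from_null O Y \oc to_null O X.

Record coproduct (C : category) (I : Type) (X : I -> C) := Coproduct {
  cop :> C;
  inj : forall i, mor (X i) cop;
  copair : forall Y : C, (forall i, mor (X i) Y) -> mor cop Y;
  copair_inj : forall (Y : C) (f : forall i, mor (X i) Y) i,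
    copair f \oc inj i = f i;
  cop_ext : forall (Y : C) (f g : mor cop Y),
    (forall i, f \oc inj i = g \oc inj i) -> f = g }.

Arguments inj {C I X} c i.
Arguments copair {C I X} c {Y} f.

Definition finite_sums (C : category) :=
  forall (I : finType) (X : I -> C), coproduct X.

Record ab_functor (C : category) := AbFunctor {
  fobj :> C -> zmodType;
  fmap : forall X Y : C, mor X Y -> {additive fobj X -> fobj Y};
  fmap1 : forall (X : C) (x : fobj X), fmap (idm X) x = x;
  fmapM : forall (X Y Z : C) (g : mor Y Z) (f : mor X Y) (x : fobj X),
    fmap (g \oc f) x = fmap g (fmap f x) }.

Arguments fmap {C} F {X Y} f : rename.

(* The structure of a preadditive category with objects Ob and morphism groups
   A X Y. *)
Record preadditive_on (Ob : Type) (A : Ob -> Ob -> zmodType) := PreadditiveOn {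
  pa_id : forall X, A X X;
  pa_comp : forall X Y Z, A Y Z -> A X Y -> A X Z;
  pa_compA : forall W X Y Z (h : A Y Z) (g : A X Y) (f : A W X),
    pa_comp h (pa_comp g f) = pa_comp (pa_comp h g) f;
  pa_comp1m : forall X Y (f : A X Y), pa_comp (pa_id Y) f = f;
  pa_compm1 : forall X Y (f : A X Y), pa_comp f (pa_id X) = f;
  pa_compDl : forall X Y Z (g g' : A Y Z) (f : A X Y),
    pa_comp (g + g') f = pa_comp g f + pa_comp g' f;
  pa_compDr : forall X Y Z (g : A Y Z) (f f' : A X Y),
    pa_comp g (f + f') = pa_comp g f + pa_comp g f' }.

Arguments pa_comp {Ob A} p {X Y Z} g f : rename.

Section QuotientMap.
Variables (V W : zmodType) (I : zmodClosed V) (J : zmodClosed W).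
Variables (f : {additive V -> W}) (fIJ : forall x, x \in I -> f x \in J).

(* The argument fIJ is only used in the proof of additivity. *)
Definition quot_fun of (forall x, x \in I -> f x \in J) :
    {ideal_quot I} -> {ideal_quot J} :=
  fun x => \pi_({ideal_quot J}) (f (repr x)).

Lemma quot_fun_pi (x : V) :
  quot_fun fIJ (\pi_({ideal_quot I}) x) = \pi_({ideal_quot J}) (f x).
Proof.
apply/eqP; rewrite /quot_fun -Quotient.idealrBE -raddfB; apply: fIJ.
by rewrite Quotient.idealrBE reprK.
Qed.

Lemma quot_fun_is_zmod_morphism : zmod_morphism (quot_fun fIJ).
Proof.
move=> x y; rewrite -[x]reprK -[y]reprK -raddfB !quot_fun_pi.
by rewrite raddfB raddfB.
Qed.

HB.instance Definition _ := GRing.isZmodMorphism.Build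
  {ideal_quot I} {ideal_quot J} (quot_fun fIJ) quot_fun_is_zmod_morphism.

Definition quot_map : {additive {ideal_quot I} -> {ideal_quot J}} :=
  quot_fun fIJ.

End QuotientMap.

Section Taylorisation.
Variables (C : category) (O : null_object C) (S : finite_sums C).

Definition omit (I : finType) (X : I -> C) (k : I) : {i | i != k} -> C :=
  fun i => X (val i).

Arguments omit {I} X k _.

(* X_1 v ... v X_m -> X_1 v ... ^X_k ... v X_m, killing the k-th summand. *)
Definition retraction (I : finType) (X : I -> C) (k : I) :
    mor (S X) (S (omit X k)) :=
  copair (S X) (fun i =>
    match sumbool_of_bool (i != k) with
    | left neq_ik => inj (S (omit X k)) (exist _ i neq_ik)
    | right _ => zerom O (X i) (S (omit X k))
    end).

Lemma zeromr (X Y Z : C) (f : mor X Y) : zerom O Y Z \oc f = zerom O X Z.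
Proof. by rewrite /zerom -compA [_ \oc f]to_null_uniq. Qed.

Lemma zeroml (X Y Z : C) (f : mor Y Z) : f \oc zerom O X Y = zerom O X Z.
Proof. by rewrite /zerom compA [f \oc _]from_null_uniq. Qed.

Definition sum_map (I : finType) (X Y : I -> C)
    (f : forall i, mor (X i) (Y i)) : mor (S X) (S Y) :=
  copair (S X) (fun i => inj (S Y) i \oc f i).

Lemma sum_map_inj (I : finType) (X Y : I -> C)
    (f : forall i, mor (X i) (Y i)) i :
  sum_map f \oc inj (S X) i = inj (S Y) i \oc f i.
Proof. exact: copair_inj. Qed.

Lemma retraction_sum_map (I : finType) (X Y : I -> C)
    (f : forall i, mor (X i) (Y i)) k :
  retraction Y k \oc sum_map f =
  sum_map (X := omit X k) (Y := omit Y k) (fun i => f (val i)) \oc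
  retraction X k.
Proof.
apply: cop_ext => i; rewrite -!compA sum_map_inj compA /retraction !copair_inj.
case: sumbool_of_bool => p; last by rewrite zeroml zeromr.
by apply/esym/(@sum_map_inj _ (omit X k) (omit Y k) (fun i => f (val i))
                            (exist _ i p)).
Qed.

(* The kernel of a map into a direct sum is the set of common zeros of its
   components. *)
Definition cr (F : ab_functor C) (m : nat) (X : 'I_m -> C) : {pred F (S X)} :=
  fun x => `[< forall k : 'I_m, fmap F (retraction X k) x = 0 >].

Arguments cr F {m} X.

Definition copies (m : nat) (X : C) : 'I_m -> C := fun=> X.

Arguments copies m X _ : clear implicits.

Definition folding (m : nat) (X : C) : mor (S (copies m X)) X :=
  copair (S (copies m X)) (fun=> idm X).

Section Functor.
Variables (n : nat) (F : ab_functor C).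

Definition taylor_rel (X : C) : {pred F X} :=
  fun x => `[< exists2 y, y \in cr F (copies n.+1 X)
                        & fmap F (folding n.+1 X) y = x >].

Arguments taylor_rel : clear implicits.

Lemma taylor_rel_zmod_closed X : zmod_closed (taylor_rel X).
Proof.
split=> [|_ _ /asboolP[x /asboolP xP <-] /asboolP[y /asboolP yP <-]].
  apply/asboolP; exists 0; last by rewrite raddf0.
  by apply/asboolP => k; rewrite raddf0.
apply/asboolP; exists (x - y); last by rewrite raddfB.
by apply/asboolP => k; rewrite raddfB xP yP subrr.
Qed.

HB.instance Definition _ X :=
  GRing.isZmodClosed.Build (F X) (taylor_rel X) (taylor_rel_zmod_closed X).

Definition taylor_obj (X : C) : zmodType := {ideal_quot (taylor_rel X)}.

Lemma taylor_rel_map (X Y : C) (f : mor X Y) (x : F X) :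
  x \in taylor_rel X -> fmap F f x \in taylor_rel Y.
Proof.
case/asboolP=> y /asboolP yP <-; apply/asboolP.
pose fs := sum_map (X := copies n.+1 X) (Y := copies n.+1 Y) (fun=> f).
exists (fmap F fs y).
  by apply/asboolP => k; rewrite -fmapM retraction_sum_map fmapM yP raddf0.
rewrite -!fmapM; congr (fmap F _ y); apply: cop_ext => i.
rewrite -!compA sum_map_inj compA /folding.
transitivity f; first by rewrite (_ : _ \oc inj _ _ = idm Y) ?comp1m ?copair_inj.
by rewrite copair_inj compm1.
Qed.

Definition taylor_map (X Y : C) (f : mor X Y) :
    {additive taylor_obj X -> taylor_obj Y} :=
  quot_map (@taylor_rel_map X Y f).

Lemma taylor_map1 X (x : taylor_obj X) : taylor_map (idm X) x = x.
Proof. by rewrite -[x]reprK [LHS]quot_fun_pi fmap1. Qed.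

Lemma taylor_mapM (X Y Z : C) (g : mor Y Z) (f : mor X Y) x :
  taylor_map (g \oc f) x = taylor_map g (taylor_map f x).
Proof.
rewrite -[x]reprK [LHS]quot_fun_pi fmapM.
by rewrite [taylor_map f _]quot_fun_pi [RHS]quot_fun_pi.
Qed.

Definition taylorisation : ab_functor C := AbFunctor taylor_map1 taylor_mapM.

Definition taylor_t (X : C) : {additive F X -> taylorisation X} :=
  \pi_({ideal_quot (taylor_rel X)}).

End Functor.

Section Representable.
Variable X : C.

Definition free_hom (Y : C) : zmodType := {freeg {classic (mor X Y)} / int}.

(* The subgroup Z[{0}] generated by the zero morphism. *)
Definition free_zero (Y : C) : {pred free_hom Y} :=
  fun D => `[< exists k : int, D = << k *g (zerom O X Y : {classic _}) >> >].

Arguments free_zero : clear implicits.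

Lemma free_zero_zmod_closed Y : zmod_closed (free_zero Y).
Proof.
split=> [|_ _ /asboolP[k ->] /asboolP[l ->]]; apply/asboolP.
  by exists 0; rewrite freegU0.
by exists (k - l); rewrite freegUB.
Qed.

HB.instance Definition _ Y :=
  GRing.isZmodClosed.Build (free_hom Y) (free_zero Y)
    (free_zero_zmod_closed Y).

Definition free_fun (Y Z : C) (g : mor Y Z) : free_hom Y -> free_hom Z :=
  fglift (fun f : {classic (mor X Y)} => << (g \oc f : {classic (mor X Z)}) >>).

Lemma free_funU Y Z (g : mor Y Z) (k : int) (f : {classic (mor X Y)}) :
  free_fun g << k *g f >> = << k *g (g \oc f : {classic (mor X Z)}) >>.
Proof.
rewrite /free_fun liftU; apply/eqP/freeg_eqP => h.
by rewrite coeffZ !coeffU mul1r.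
Qed.

Lemma free_fun_is_zmod_morphism Y Z (g : mor Y Z) : zmod_morphism (free_fun g).
Proof. exact: lift_is_additive. Qed.

HB.instance Definition _ Y Z (g : mor Y Z) := GRing.isZmodMorphism.Build
  (free_hom Y) (free_hom Z) (free_fun g) (free_fun_is_zmod_morphism g).

Lemma free_fun_zero Y Z (g : mor Y Z) (D : free_hom Y) :
  D \in free_zero Y -> free_fun g D \in free_zero Z.
Proof.
case/asboolP=> k ->; apply/asboolP; exists k.
by rewrite free_funU zeroml.
Qed.

Lemma free_fun1 Y (D : free_hom Y) : free_fun (idm Y) D = D.
Proof.
rewrite -[D]freeg_sumE raddf_sum; apply: eq_bigr => f _.
by rewrite /= free_funU comp1m.
Qed.

Lemma free_funM Y Z W (h : mor Z W) (g : mor Y Z) (D : free_hom Y) :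
  free_fun (h \oc g) D = free_fun h (free_fun g D).
Proof.
rewrite -[D]freeg_sumE !raddf_sum; apply: eq_bigr => f _.
by rewrite /= !free_funU compA.
Qed.

Definition U_obj (Y : C) : zmodType := {ideal_quot (free_zero Y)}.

Definition U_map (Y Z : C) (g : mor Y Z) : {additive U_obj Y -> U_obj Z} :=
  quot_map (@free_fun_zero Y Z g).

Lemma U_map1 Y (x : U_obj Y) : U_map (idm Y) x = x.
Proof. by rewrite -[x]reprK [LHS]quot_fun_pi /= free_fun1. Qed.

Lemma U_mapM Y Z W (h : mor Z W) (g : mor Y Z) (x : U_obj Y) :
  U_map (h \oc g) x = U_map h (U_map g x).
Proof.
rewrite -[x]reprK [LHS]quot_fun_pi /= free_funM.
by rewrite [U_map g _]quot_fun_pi [RHS]quot_fun_pi.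
Qed.

Definition Ufun : ab_functor C := AbFunctor U_map1 U_mapM.

Definition U_class (Y : C) (f : mor X Y) : Ufun Y :=
  \pi_({ideal_quot (free_zero Y)}) << (f : {classic (mor X Y)}) >>.

End Representable.

Definition TU (n : nat) (X Y : C) : zmodType := taylorisation n (Ufun X) Y.

Definition t_class (n : nat) (X Y : C) (f : mor X Y) : TU n X Y :=
  taylor_t n (Ufun X) Y (U_class f).

End Taylorisation.

(* Main.v *)
Require Import Defs.
From HB Require Import structures.
From mathcomp Require Import all_boot all_algebra ring_quotient.
From mathcomp Require Import boolp freeg.

Set Implicit Arguments.
Unset Strict Implicit.
Unset Printing Implicit Defensive.

Import GRing.Theory.
Local Open Scope ring_scope.
Local Open Scope quotient_scope.

(** The morphism group TU X Y is the quotient of the free abelian group on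
    mor X Y by a subgroup I(X, Y), so what has to be seen is that the bilinear
    extension of composition passes to these quotients, that is, that the
    subgroups I(X, Y) form a two-sided ideal.

    Both halves are instances of functoriality of Taylorisation.
    Postcomposition with g : Y -> Z is the action of the functor T_n U_X on g.
    Precomposition with f : X -> Y is a natural transformation U_Y -> U_X, and
    a natural transformation F -> G commutes with the retractions and the
    folding maps, hence carries cross-effects to cross-effects and induces
    T_n F -> T_n G ([taylor_rel_nat], [T_precomp]).

    The composite of b and a is built one variable at a time: a formal
    combination D of morphisms Y -> Z acts on a in TU X Y by postcomposition
    ([free_act]), and this is biadditive. When a is the class of a morphism f,
    the result is the image of the class of D under precomposition with f, so
    it depends on D only through its class; by additivity in a this holds for
    every a ([free_act_eq]). Since the classes t f generate TU X Y
    ([TU_ind]), biadditivity reduces associativity and the unit laws to those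
    of the original category. *)

Section NaturalMap.
Variables (C : category) (O : null_object C) (S : finite_sums C) (n : nat).
Variables (F G : ab_functor C) (eta : forall X, {additive F X -> G X}).
Hypothesis eta_nat : forall (X Y : C) (f : mor X Y) (x : F X),
  eta Y (fmap F f x) = fmap G f (eta X x).

(** Naturality with respect to the retractions keeps a cross-effect in the
    cross-effect; naturality with respect to the folding map keeps its image in
    the image. *)
Lemma taylor_rel_nat X (x : F X) :
  x \in taylor_rel O S n (F := F) (X := X) -> eta X x \in taylor_rel O S n (F := G) (X := X).
Proof.
case/asboolP=> y /asboolP yP <-; apply/asboolP.
exists (eta _ y); last by rewrite eta_nat.
by apply/asboolP => k; rewrite -eta_nat yP raddf0.
Qed.

Definition taylor_nat X :
    {additive taylorisation O S n F X -> taylorisation O S n G X} :=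
  quot_map (@taylor_rel_nat X).

Lemma taylor_nat_t X (x : F X) :
  taylor_nat X (taylor_t O S n F X x) = taylor_t O S n G X (eta X x).
Proof. exact: quot_fun_pi. Qed.

End NaturalMap.

Section Composition.
Variables (C : category) (O : null_object C) (S : finite_sums C) (n : nat).

Local Notation T := (TU O S n).
Local Notation t f := (t_class O S n f).

Section FreeLift.
Variables (X Y : C) (V : zmodType) (phi : mor X Y -> V).

(** The universal property of Z[Hom(X, Y)] for maps to any abelian group,
    which is regarded as a Z-module so that linear extension applies. *)
Definition free_lift : free_hom X Y -> V :=
  @fglift int (zmodule V) {classic (mor X Y)} phi.

Lemma free_lift_is_zmod_morphism : zmod_morphism free_lift.
Proof. exact: (@lift_is_additive int _ (zmodule V)). Qed.

HB.instance Definition _ := GRing.isZmodMorphism.Build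
  (free_hom X Y) V free_lift free_lift_is_zmod_morphism.

Lemma free_liftU k (f : {classic (mor X Y)}) :
  free_lift << k *g f >> = phi f *~ k.
Proof. exact: (@liftU int (zmodule V) {classic (mor X Y)} phi). Qed.

End FreeLift.

Definition free_t (X Y : C) (D : free_hom X Y) : T X Y :=
  taylor_t O S n (Ufun O X) Y (\pi_({ideal_quot (free_zero O (X := X) (Y := Y))}) D).

Lemma free_t_is_zmod_morphism X Y : zmod_morphism (@free_t X Y).
Proof. by move=> D E; rewrite /free_t !raddfB. Qed.

HB.instance Definition _ X Y := GRing.isZmodMorphism.Build
  (free_hom X Y) (T X Y) (@free_t X Y) (@free_t_is_zmod_morphism X Y).

(** TU X Y is a quotient of a quotient: first by the zero morphism, then by the
    image of the cross-effect. Hence two choices of representative. *)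
Definition free_repr (X Y : C) (a : T X Y) : free_hom X Y := repr (repr a).

Lemma free_reprK X Y (a : T X Y) : free_t (free_repr a) = a.
Proof. by rewrite /free_t /free_repr reprK; apply: reprK. Qed.

(** The classes t f generate TU X Y as a group: it is a quotient of the free
    abelian group on the morphisms. *)
Lemma TU_ind X Y (P : T X Y -> Prop) :
  P 0 -> (forall a b, P a -> P b -> P (a - b)) -> (forall f, P (t f)) ->
  forall a, P a.
Proof.
move=> P0 PB Pt a; rewrite -[a]free_reprK.
have PN b : P b -> P (- b) by move=> Pb; rewrite -sub0r; apply: PB.
have PD b c : P b -> P c -> P (b + c).
  by move=> Pb Pc; rewrite -[c]opprK; apply/PB/PN.
have PMn b m : P b -> P (b *+ m).
  by move=> Pb; elim: m => // m IH; rewrite mulrS; apply: PD.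
elim/freeg_ind_dom0: (free_repr a) => [|k f D _ _ PD']; first by rewrite raddf0.
rewrite raddfD; apply: PD => //.
rewrite -[k]intz -freegU_mulz raddfMz.
by case: k => m; [|apply: PN]; apply: PMn; apply: Pt.
Qed.

Section Precomp.
Variables (X Y : C) (f : mor X Y).

Definition free_precomp (Z : C) : {additive free_hom Y Z -> free_hom X Z} :=
  free_lift (fun g => << (g \oc f : {classic (mor X Z)}) >> : free_hom X Z).

Lemma free_precompU Z k (g : {classic (mor Y Z)}) :
  free_precomp Z << k *g g >> = << k *g (g \oc f : {classic (mor X Z)}) >>.
Proof. by rewrite [LHS]free_liftU freegU_mulz intz. Qed.

Lemma free_precomp_zero Z (D : free_hom Y Z) :
  D \in free_zero O (X := Y) (Y := Z) -> free_precomp Z D \in free_zero O (X := X) (Y := Z).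
Proof.
case/asboolP=> k ->; apply/asboolP; exists k.
by rewrite free_precompU zeromr.
Qed.

(** Pre- and postcomposition commute by associativity; this is the naturality
    in the target that lets precomposition descend to the Taylorisations. *)
Lemma free_precomp_nat Z W (h : mor Z W) (D : free_hom Y Z) :
  free_precomp W (free_fun h D) = free_fun h (free_precomp Z D).
Proof.
rewrite -[D]freeg_sumE !raddf_sum; apply: eq_bigr => g _.
by rewrite /= free_funU !free_precompU free_funU Defs.compA.
Qed.

Definition U_precomp Z : {additive Ufun O Y Z -> Ufun O X Z} :=
  quot_map (@free_precomp_zero Z).

Lemma U_precomp_nat Z W (h : mor Z W) (x : Ufun O Y Z) :
  U_precomp W (fmap (Ufun O Y) h x) = fmap (Ufun O X) h (U_precomp Z x).
Proof.
rewrite -[x]reprK [fmap _ h _]quot_fun_pi [U_precomp W _]quot_fun_pi.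
by rewrite [U_precomp Z _]quot_fun_pi [RHS]quot_fun_pi /= free_precomp_nat.
Qed.

Definition T_precomp Z : {additive T Y Z -> T X Z} :=
  taylor_nat O S n U_precomp_nat Z.

Lemma T_precomp_t Z (g : mor Y Z) : T_precomp Z (t g) = t (g \oc f).
Proof.
rewrite [LHS]taylor_nat_t; congr (taylor_t _ _ _ _ _ _).
by rewrite [LHS]quot_fun_pi free_precompU.
Qed.

End Precomp.

Definition T_postcomp (X Y Z : C) (g : mor Y Z) : {additive T X Y -> T X Z} :=
  fmap (taylorisation O S n (Ufun O X)) g.

Lemma T_postcomp_t X Y Z (g : mor Y Z) (f : mor X Y) :
  T_postcomp X g (t f) = t (g \oc f).
Proof.
rewrite [LHS]quot_fun_pi; congr (\pi _).
by rewrite [LHS]quot_fun_pi /= free_funU.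
Qed.

(** The composition before its left argument is passed to the quotient: D acts
    through the functor T_n U_X, so the right argument is already a class. *)
Definition free_act (X Y Z : C) (D : free_hom Y Z) (a : T X Y) : T X Z :=
  free_lift (fun g => T_postcomp X g a) D.

Lemma free_actBl X Y Z (D E : free_hom Y Z) (a : T X Y) :
  free_act (D - E) a = free_act D a - free_act E a.
Proof. exact: raddfB. Qed.

Lemma free_actBr X Y Z (D : free_hom Y Z) (a b : T X Y) :
  free_act D (a - b) = free_act D a - free_act D b.
Proof.
rewrite /free_act -[D]freeg_sumE !raddf_sum -big_split; apply: eq_bigr => g _.
by rewrite /= !free_liftU raddfB mulrzBl.
Qed.

(** On generators of the right argument the action is precomposition, which is
    defined on classes; this is where the right ideal property enters. *)
Lemma free_act_t X Y Z (D : free_hom Y Z) (f : mor X Y) :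
  free_act D (t f) = T_precomp f Z (free_t D).
Proof.
rewrite /free_act -[D]freeg_sumE !raddf_sum; apply: eq_bigr => g _ /=.
rewrite free_liftU T_postcomp_t -T_precomp_t -[X in << X *g _ >>]intz.
by rewrite -freegU_mulz !raddfMz.
Qed.

(** Makes the composition independent of the representative of its left
    argument: both sides are additive in a, so a may be taken to be the class
    of a morphism. *)
Lemma free_act_eq X Y Z (D E : free_hom Y Z) (a : T X Y) :
  free_t D = free_t E -> free_act D a = free_act E a.
Proof.
move=> DE; elim/TU_ind: a => [|a b Ha Hb|f]; last by rewrite !free_act_t DE.
  by rewrite -[0](subrr 0) !free_actBr !subrr.
by rewrite !free_actBr Ha Hb.
Qed.

Definition T_comp (X Y Z : C) (b : T Y Z) (a : T X Y) : T X Z :=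
  free_act (free_repr b) a.

Lemma T_compBl X Y Z (b c : T Y Z) (a : T X Y) :
  T_comp (b - c) a = T_comp b a - T_comp c a.
Proof.
by rewrite /T_comp -free_actBl; apply: free_act_eq; rewrite [RHS]raddfB /= !free_reprK.
Qed.

Lemma T_compBr X Y Z (b : T Y Z) (a c : T X Y) :
  T_comp b (a - c) = T_comp b a - T_comp b c.
Proof. exact: free_actBr. Qed.

Lemma T_comp0l X Y Z (a : T X Y) : T_comp (0 : T Y Z) a = 0.
Proof. by rewrite -[0 in LHS](subrr 0) T_compBl subrr. Qed.

Lemma T_comp0r X Y Z (b : T Y Z) : T_comp b (0 : T X Y) = 0.
Proof. by rewrite -[0 in LHS](subrr 0) T_compBr subrr. Qed.

Lemma T_comp_t X Y Z (g : mor Y Z) (f : mor X Y) :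
  T_comp (t g) (t f) = t (g \oc f).
Proof. by rewrite /T_comp free_act_t free_reprK T_precomp_t. Qed.

Lemma T_compA W X Y Z (c : T Y Z) (b : T X Y) (a : T W X) :
  T_comp c (T_comp b a) = T_comp (T_comp c b) a.
Proof.
elim/TU_ind: a => [|a a' Ha Ha'|f]; first by rewrite !T_comp0r.
  by rewrite !T_compBr Ha Ha'.
elim/TU_ind: b => [|b b' Hb Hb'|g]; first by rewrite !(T_comp0r, T_comp0l).
  by rewrite !(T_compBr, T_compBl) Hb Hb'.
elim/TU_ind: c => [|c c' Hc Hc'|h]; first by rewrite !T_comp0l.
  by rewrite !T_compBl Hc Hc'.
by rewrite !T_comp_t Defs.compA.
Qed.

Lemma T_comp1l X Y (a : T X Y) : T_comp (t (idm Y)) a = a.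
Proof.
elim/TU_ind: a => [|a b Ha Hb|f]; first by rewrite T_comp0r.
  by rewrite T_compBr Ha Hb.
by rewrite T_comp_t comp1m.
Qed.

Lemma T_comp1r X Y (a : T X Y) : T_comp a (t (idm X)) = a.
Proof.
elim/TU_ind: a => [|a b Ha Hb|f]; first by rewrite T_comp0l.
  by rewrite T_compBl Ha Hb.
by rewrite T_comp_t compm1.
Qed.

Lemma T_compDl X Y Z (b c : T Y Z) (a : T X Y) :
  T_comp (b + c) a = T_comp b a + T_comp c a.
Proof. by apply/eqP; rewrite -subr_eq -T_compBl addrK. Qed.

Lemma T_compDr X Y Z (b : T Y Z) (a c : T X Y) :
  T_comp b (a + c) = T_comp b a + T_comp b c.
Proof. by apply/eqP; rewrite -subr_eq -T_compBr addrK. Qed.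

Definition T_preadditive : preadditive_on T :=
  PreadditiveOn T_compA T_comp1l T_comp1r T_compDl T_compDr.

End Composition.

Theorem proposition5p21 (C : category) (O : null_object C) (S : finite_sums C)
    (n : nat) (hn : (1 <= n)%N) :
  exists P : preadditive_on (TU O S n),
    forall (X Y Z : C) (f : mor X Y) (g : mor Y Z),
      pa_comp P (t_class O S n g) (t_class O S n f) = t_class O S n (mcomp g f).
Proof. by exists (T_preadditive O S n) => X Y Z f g; apply: T_comp_t. Qed.
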